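(* There exist a set $A$ of size $6$ and two linear orders $P$ and $Q$ on $A$ such that there are multiple (at least two) pairwise non-isomorphic maximal Arrow's single-peaked domains on $A$ having $P$ and $Q$ as extremal paths.
   Context: A linear order on a finite set $A$ of size $m$ is identified with a directed Hamilton path through $A$, i.e. a sequence $(a_1,\dots,a_m)$ listing every element of $A$ exactly once (most preferred first). A set $D$ of linear orders on $A$ is a Condorcet domain if there are no three orders in $D$ and distinct $a_1,a_2,a_3\in A$ such that the three orders rank these elements as $a_1\succ a_2\succ a_3$, $a_2\succ a_3\succ a_1$, $a_3\succ a_1\succ a_2$ respectively. It is maximal if it is not properly contained in another Condorcet domain on $A$. An Arrow's single-peaked domain is a Condorcet domain $D$ such that every triple (3-element subset) $T\subseteq A$ has a ''never-bottom'' element, i.e. an element of $T$ which no order of $D$ ranks last among the elements of $T$. A maximal Arrow's single-peaked domain is an Arrow's single-peaked domain which is maximal as a Condorcet domain. A terminal element of $D$ is an element which is last in some order of $D$; a maximal Arrow's single-peaked domain has exactly two terminal elements. A path in $D$ is extremal if it starts at one terminal element and ends at the other; such a $D$ has exactly two extremal paths. Two domains are isomorphic if some bijection of the underlying sets carries one onto the other. *)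

(* Defs.v *)
From HB Require Import structures.
From mathcomp Require Import all_boot.
Set Implicit Arguments.
Unset Strict Implicit.
Unset Printing Implicit Defensive.

(* A duplicate-free sequence of length #|A| lists every element of A exactly
   once; the most preferred element comes first. *)
Record linorder (A : finType) := LinOrder {
  path_of :> #|A|.-tuple A;
  _ : uniq path_of }.

HB.instance Definition _ (A : finType) := [isSub for @path_of A].
HB.instance Definition _ (A : finType) := [Finite of linorder A by <:].

Definition prefers (A : finType) (P : linorder A) (a b : A) : bool :=
  index a P < index b P.

Definition ranks (A : finType) (P : linorder A) (a b c : A) : bool :=
  prefers P a b && prefers P b c.

Definition condorcet (A : finType) (D : {set linorder A}) : Prop :=
  ~ exists P1 P2 P3 : linorder A, exists a1 a2 a3 : A,
      [/\ [/\ P1 \in D, P2 \in D & P3 \in D], uniq [:: a1; a2; a3],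
          ranks P1 a1 a2 a3, ranks P2 a2 a3 a1 & ranks P3 a3 a1 a2].

Definition maximal_condorcet (A : finType) (D : {set linorder A}) : Prop :=
  condorcet D /\
  ~ exists E : {set linorder A}, condorcet E /\ D \proper E.

Definition ranked_last (A : finType) (P : linorder A) (T : {set A}) (x : A) :
    bool :=
  (x \in T) && [forall y in T, (y != x) ==> prefers P y x].

Definition never_bottom (A : finType) (D : {set linorder A}) (T : {set A})
    (x : A) : Prop :=
  x \in T /\ forall P, P \in D -> ~~ ranked_last P T x.

Definition arrow_single_peaked (A : finType) (D : {set linorder A}) : Prop :=
  condorcet D /\
  forall T : {set A}, #|T| = 3 -> exists x, never_bottom D T x.

(* Maximality is among all Condorcet domains, not only among Arrow's
   single-peaked ones. *)
Definition maximal_arrow_single_peaked (A : finType) (D : {set linorder A}) :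
    Prop :=
  arrow_single_peaked D /\ maximal_condorcet D.

(* P is nonempty as soon as A has an element a, so the default value a is
   never returned by [head] or [last]. *)
Definition starts_at (A : finType) (P : linorder A) (a : A) : bool :=
  head a P == a.

Definition ends_at (A : finType) (P : linorder A) (a : A) : bool :=
  last a P == a.

Definition terminal (A : finType) (D : {set linorder A}) : {set A} :=
  [set a | [exists P in D, ends_at P a]].

Definition extremal_path (A : finType) (D : {set linorder A})
    (P : linorder A) : Prop :=
  P \in D /\
  exists a b : A,
    [/\ a != b, terminal D = [set a; b], starts_at P a & ends_at P b].

Definition orders (A : finType) (D : {set linorder A}) : seq (seq A) :=
  [seq tval (path_of P) | P in D].

Definition isomorphic (A B : finType) (D : {set linorder A})
    (E : {set linorder B}) : Prop :=
  exists2 f : A -> B, bijective f & [seq map f s | s <- orders D] =i orders E.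

(* Main.v *)
Require Import Defs.
From mathcomp Require Import all_boot.

(** Call a domain guarded when it consists of all the orders that rank, in every
    triple, a prescribed element of that triple not last.  Such a domain is
    Arrow's single-peaked.  It is maximal among all Condorcet domains as soon as
    it is rich: every triple, with guard x and other elements y and z, is ranked
    both y, x, z and x, y, z by orders of the domain.  For an order outside the
    domain ranks some triple y, z, x with its guard x last, and together with the
    orders ranking z, x, y and x, y, z it forms a Condorcet cycle
    (lemma [guarded_domain_maximal]).

    On {0,..,5} take first the guard of a triple to be its least nonzero element;
    in a second domain the triple {1,2,3} is guarded by 2 instead of 1.  Both
    domains are rich, as thirteen explicit orders of each show.  In both, each of
    1, 2, 3, 4 guards its triple with 0 and 5, so only 0 and 5 can be last
    overall, and the orders 0,1,2,3,4,5 and 5,1,2,3,4,0 belong to both and are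
    extremal.

    The two domains are not isomorphic: in the first, 1 guards every triple that
    contains it, hence is among the two best elements of every order, whereas in
    the second every element is in third position or lower in some order.  The
    existence of an element that is always among the two best is invariant under
    isomorphism (lemma [isomorphic_top_two]). *)

Set Implicit Arguments.
Unset Strict Implicit.
Unset Printing Implicit Defensive.

(** * Orders, triples and Condorcet domains *)

Section Orders.

Variable A : finType.
Implicit Types (P Q : linorder A) (D : {set linorder A}) (T : {set A}).

Lemma linorder_uniq P : uniq P.
Proof. by case: P. Qed.

Lemma mem_linorder P (a : A) : a \in (P : seq A).
Proof.
have /uniq_min_size : uniq P := linorder_uniq P.
case/(_ (enum A)) => [b _| |_ ->]; rewrite ?mem_enum //.
by rewrite -cardE size_tuple.
Qed.

Lemma prefers_total P (a b : A) : a != b -> prefers P a b || prefers P b a.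
Proof.
move=> neq_ab; rewrite /prefers -neq_ltn; apply: contraNneq neq_ab.
by move/(index_inj a (mem_linorder P a) (mem_linorder P b))->.
Qed.

Lemma prefersN P (a b : A) : a != b -> ~~ prefers P a b -> prefers P b a.
Proof. by move=> /(prefers_total P)/orP[-> //|]. Qed.

Lemma prefers_asym P (a b : A) : prefers P a b -> ~~ prefers P b a.
Proof. by rewrite /prefers -leqNgt; exact: ltnW. Qed.

Lemma ends_at_prefers P (a b : A) : ends_at P a -> ~~ prefers P a b.
Proof.
rewrite /ends_at /prefers -leqNgt => /eqP.
have := mem_linorder P b; have := linorder_uniq P.
case: (tval P) => [|c s] // uniq_s; rewrite -index_mem ltnS => b_s <-.
by rewrite [last _ _]/= index_last.
Qed.

Lemma triple_elements T :
  #|T| = 3 -> exists x y z, uniq [:: x; y; z] /\ T =i [:: x; y; z].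
Proof.
move=> card_T; have := enum_uniq T; have := card_T; rewrite cardE.
have := mem_enum T; case: (enum T) => [|x [|y [|z []]]] // mem_T _ uniq_T.
by exists x, y, z; split=> // a; rewrite mem_T.
Qed.

(** A Condorcet cycle on a triple ranks each of its elements last once, so the
    never-bottom element of the triple excludes it. *)
Lemma never_bottom_condorcet D :
  (forall T, #|T| = 3 -> exists x, never_bottom D T x) -> condorcet D.
Proof.
move=> nbD [P1 [P2 [P3 [a1 [a2 [a3 [[D1 D2 D3] uniq_a r1 r2 r3]]]]]]].
pose T := [set a in [:: a1; a2; a3]].
have lastT P x y z : (forall a, (a \in T) = (a \in [:: x; y; z])) ->
    ranks P x y z -> ranked_last P T z.
  move=> T_xyz /andP[xy yz]; rewrite /ranked_last T_xyz !inE eqxx !orbT /=.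
  apply/forall_inP => a; rewrite T_xyz !inE.
  case/or3P=> /eqP->; rewrite ?yz ?implybT ?eqxx //.
  by rewrite /prefers (ltn_trans xy yz) implybT.
have [|x [xT nbx]] := nbD T.
  by rewrite cardsE; apply/eqP; move/card_uniqP: uniq_a => ->.
move: xT; rewrite !inE => /or3P[] /eqP def_x; subst x.
- by have /negP[] := nbx _ D2; apply: lastT r2 => a; rewrite !inE orbC orbA orbC.
- have /negP[] := nbx _ D3; apply: lastT r3 => a; rewrite !inE.
  by rewrite orbA orbC.
- by have /negP[] := nbx _ D1; apply: lastT r1 => a; rewrite !inE.
Qed.

(** * Guarded domains *)

(** [guards x y z] says that [x] is the prescribed never-bottom element of the
    triple [x], [y], [z]. *)
Definition guarded_domain (guards : A -> A -> A -> bool) : {set linorder A} :=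
  [set P | [forall x, forall y, forall z,
    uniq [:: x; y; z] && guards x y z ==> prefers P x y || prefers P x z]].

Lemma guarded_domainP (guards : A -> A -> A -> bool) P :
  reflect (forall x y z, uniq [:: x; y; z] -> guards x y z ->
             prefers P x y || prefers P x z)
          (P \in guarded_domain guards).
Proof.
rewrite inE; apply: (iffP forallP) => [gP x y z uniq_xyz g_xyz|gP x].
  by have /forallP/(_ y)/forallP/(_ z) := gP x; rewrite uniq_xyz g_xyz.
apply/forallP => y; apply/forallP => z; apply/implyP => /andP[].
exact: gP.
Qed.

(** If an order outside the domain ranks some triple [y], [z], [x] with the guard
    [x] last, richness completes it to the Condorcet cycle [y z x], [z x y],
    [x y z]. *)
Lemma guarded_domain_maximal (guards : A -> A -> A -> bool) :
    (forall x y z, uniq [:: x; y; z] -> guards x y z -> guards x z y) ->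
    (forall x y z, uniq [:: x; y; z] ->
       [|| guards x y z, guards y z x | guards z x y]) ->
    (forall x y z, uniq [:: x; y; z] -> guards x y z ->
       (exists2 P, P \in guarded_domain guards & ranks P y x z) /\
       (exists2 P, P \in guarded_domain guards & ranks P x y z)) ->
  maximal_arrow_single_peaked (guarded_domain guards).
Proof.
set D := guarded_domain guards => guardsC guards_total rich.
have rot3 (x y z : A) : uniq [:: x; y; z] -> uniq [:: y; z; x].
  by rewrite -(rot_uniq 1).
have nbD T : #|T| = 3 -> exists x, never_bottom D T x.
  move=> /triple_elements[x0 [y0 [z0 [uniq0 T0]]]].
  have [x [y [z [uniq_xyz T_xyz g_xyz]]]] : exists x y z,
      [/\ uniq [:: x; y; z], T =i [:: x; y; z] & guards x y z].
    case/or3P: (guards_total _ _ _ uniq0) => g.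
    - by exists x0, y0, z0.
    - exists y0, z0, x0; split=> // [|a]; first exact: rot3.
      by rewrite T0 -(mem_rot 1).
    - exists z0, x0, y0; split=> // [|a]; first exact/rot3/rot3.
      by rewrite T0 -(mem_rot 2).
  exists x; split=> [|P /guarded_domainP gP]; first by rewrite T_xyz mem_head.
  rewrite /ranked_last negb_and; apply/orP; right.
  apply/negP => /forall_inP last_x.
  move: (uniq_xyz) => /=; rewrite !inE negb_or => /and3P[/andP[xy xz] _ _].
  have := gP _ _ _ uniq_xyz g_xyz; apply/negP; rewrite negb_or.
  rewrite !prefers_asym //; first apply: (implyP (last_x z _));
    rewrite ?T_xyz ?inE ?eqxx ?orbT 1?eq_sym //.
  by apply: (implyP (last_x y _)); rewrite ?T_xyz ?inE ?eqxx ?orbT 1?eq_sym.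
have condD : condorcet D by exact: never_bottom_condorcet.
split; split=> // -[E [condE /properP[sDE [P PE PD]]]].
have [x [y [z [uniq_xyz g_xyz yx zx yz]]]] : exists x y z,
    [/\ uniq [:: x; y; z], guards x y z, prefers P y x, prefers P z x
      & prefers P y z].
  move: PD; rewrite inE negb_forall => /existsP[x].
  rewrite negb_forall => /existsP[y]; rewrite negb_forall => /existsP[z].
  rewrite negb_imply negb_or => /andP[/andP[uniq_xyz g_xyz] /andP[Nxy Nxz]].
  move: (uniq_xyz) => /=; rewrite !inE negb_or => /and3P[/andP[xy xz] yz _].
  have [yx zx] := (prefersN xy Nxy, prefersN xz Nxz).
  have /orP[pyz|pzy] := prefers_total P yz; first by exists x, y, z.
  exists x, z, y; split=> //; last exact: guardsC.
  by rewrite /= !inE negb_or xz xy eq_sym yz.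
have uniq_xzy : uniq [:: x; z; y].
  by move: uniq_xyz; rewrite /= !inE !negb_or (andbC (x != y)) (eq_sym z).
have [_ [P3 D3 r3]] := rich _ _ _ uniq_xyz g_xyz.
have [[P2 D2 r2] _] := rich _ _ _ uniq_xzy (guardsC _ _ _ uniq_xyz g_xyz).
apply: condE; exists P, P2, P3, y, z, x; split=> //.
- by split=> //; exact: (subsetP sDE).
- exact: rot3.
- by rewrite /ranks yz zx.
Qed.

Lemma guarded_not_terminal (guards : A -> A -> A -> bool) (x y z : A) :
  uniq [:: x; y; z] -> guards x y z -> x \notin terminal (guarded_domain guards).
Proof.
move=> uniq_xyz g_xyz; rewrite inE.
apply/negP => /exists_inP[P /guarded_domainP gP last_x].
by have := gP _ _ _ uniq_xyz g_xyz; rewrite !(negPf (ends_at_prefers _ last_x)).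
Qed.

Lemma always_guard_top_two (guards : A -> A -> A -> bool) (x : A) P :
    (forall y z, uniq [:: x; y; z] -> guards x y z) ->
  P \in guarded_domain guards -> index x P < 2.
Proof.
move=> g_x /guarded_domainP gP; rewrite ltnNge; apply/negP.
have := linorder_uniq P; have := gP x; rewrite /prefers.
case: (tval P) => [|y [|z s]] //=; first by case: (y == x).
move=> {}gP /andP[]; rewrite inE negb_or => /andP[neq_yz _] _.
case: (altP (y =P x)) => // neq_yx; case: (altP (z =P x)) => // neq_zx _.
have uniq_xyz : uniq [:: x; y; z].
  by rewrite /= !inE negb_or neq_yz !(eq_sym x) neq_yx neq_zx.
have := gP _ _ uniq_xyz (g_x _ _ uniq_xyz).
by rewrite !eqxx (negPf neq_yx) (negPf neq_yz) (negPf neq_zx).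
Qed.

End Orders.

Lemma isomorphic_top_two (A B : finType) (D : {set linorder A})
    (E : {set linorder B}) :
    isomorphic D E -> (exists a, forall P, P \in D -> index a P < 2) ->
  exists b, forall Q, Q \in E -> index b Q < 2.
Proof.
move=> [f bij_f fDE] [a a_top]; exists (f a) => Q QE.
have : tval (path_of Q) \in orders E by apply: image_f.
rewrite -fDE => /mapP[_ /imageP[P PD ->] ->].
by rewrite index_map; [exact: a_top | exact: bij_inj].
Qed.

(** * Guarded domains on six elements, decided by computation *)

(** Elements are handled through their values, and an order through its sequence
    of values, because ['I_6] and its cardinality do not compute. *)
Definition all_triples (p : nat -> nat -> nat -> bool) : bool :=
  all (fun x => all (fun y => all (fun z => uniq [:: x; y; z] ==> p x y z)
    (iota 0 6)) (iota 0 6)) (iota 0 6).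

Lemma all_triplesP p (x y z : 'I_6) :
  all_triples p -> uniq [:: x; y; z] -> p x y z.
Proof.
have mem_I6 (i : 'I_6) : val i \in iota 0 6 by rewrite mem_iota /=.
move=> /allP/(_ _ (mem_I6 x))/allP/(_ _ (mem_I6 y))/allP/(_ _ (mem_I6 z)).
by rewrite -(map_inj_uniq val_inj) => /implyP.
Qed.

Lemma linorder_of_seq (s : seq nat) :
  perm_eq s (iota 0 6) -> exists P : linorder 'I_6, map val P = s.
Proof.
move=> perm_s; pose t : seq 'I_6 := map inord s.
have val_t : map val t = s.
  rewrite -map_comp map_id_in // => i.
  by rewrite (perm_mem perm_s) mem_iota => /inordK.
have size_t : size t == #|'I_6|.
  by rewrite size_map (perm_size perm_s) size_iota card_ord.
have uniq_t : uniq (Tuple size_t).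
  by rewrite /= -(map_inj_uniq val_inj) val_t (perm_uniq perm_s) iota_uniq.
by exists (LinOrder uniq_t).
Qed.

Lemma prefers_val (P : linorder 'I_6) (a b : 'I_6) :
  prefers P a b = (index (val a) (map val P) < index (val b) (map val P)).
Proof. by rewrite !(index_map val_inj). Qed.

Section Computation.

Variable guards : nat -> nat -> nat -> bool.

Definition guarded6 : {set linorder 'I_6} :=
  guarded_domain (fun x y z : 'I_6 => guards x y z).

Definition respects (s : seq nat) : bool :=
  perm_eq s (iota 0 6) &&
  all_triples (fun x y z => guards x y z ==>
    (index x s < index y s) || (index x s < index z s)).

Lemma mem_guarded6 (P : linorder 'I_6) :
  respects (map val P) -> P \in guarded6.
Proof.
move=> /andP[_ g_P]; apply/guarded_domainP => x y z uniq_xyz g_xyz.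
rewrite !prefers_val; exact: implyP (all_triplesP g_P uniq_xyz) g_xyz.
Qed.

Lemma respects_guarded6 s :
  respects s -> exists2 P, P \in guarded6 & map val P = s.
Proof.
move=> s_resp; have /andP[/linorder_of_seq[P def_P] _] := s_resp.
by exists P => //; apply: mem_guarded6; rewrite def_P.
Qed.

Definition lists (x y z : nat) (s : seq nat) : bool :=
  (index x s < index y s) && (index y s < index z s).

Definition rich_witnesses (W : seq (seq nat)) : bool :=
  [&& all respects W,
      all_triples (fun x y z => guards x y z ==> guards x z y),
      all_triples (fun x y z => [|| guards x y z, guards y z x | guards z x y])
    & all_triples (fun x y z =>
        guards x y z ==> has (lists y x z) W && has (lists x y z) W)].

Lemma guarded6_maximal W :
  rich_witnesses W -> maximal_arrow_single_peaked guarded6.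
Proof.
case/and4P=> /allP W_guarded gC g_total rich.
have witness (x y z : 'I_6) :
    has (lists x y z) W -> exists2 P, P \in guarded6 & ranks P x y z.
  case/hasP=> s /W_guarded/respects_guarded6[P PD <-] xyz.
  by exists P => //; rewrite /ranks !prefers_val.
apply: guarded_domain_maximal => x y z uniq_xyz.
- exact: implyP (all_triplesP gC uniq_xyz).
- exact: all_triplesP g_total uniq_xyz.
- by case/(implyP (all_triplesP rich uniq_xyz))/andP=> /witness ? /witness.
Qed.

End Computation.

(** * The two domains *)

Definition least_nonzero (x y z : nat) : bool :=
  [&& 0 < x, (y == 0) || (x < y) & (z == 0) || (x < z)].

Definition least_nonzero_but_123 (x y z : nat) : bool :=
  if perm_eq [:: x; y; z] [:: 1; 2; 3] then x == 2 else least_nonzero x y z.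

Definition common_orders : seq (seq nat) :=
  [:: [:: 0; 1; 2; 3; 4; 5]; [:: 5; 1; 2; 3; 4; 0]; [:: 4; 1; 2; 3; 0; 5];
      [:: 2; 1; 3; 5; 4; 0]; [:: 1; 2; 0; 3; 4; 5]; [:: 1; 2; 4; 3; 5; 0];
      [:: 1; 5; 2; 3; 4; 0]; [:: 1; 4; 2; 3; 0; 5]; [:: 1; 0; 2; 3; 4; 5];
      [:: 1; 2; 3; 0; 4; 5]; [:: 1; 2; 5; 3; 4; 0]].

(** The orders common to the two domains all rank 3 last in the triple {1,2,3};
    two further orders in each domain supply the rankings of that triple which
    rank 2, respectively 1, last. *)
Definition orders1 : seq (seq nat) :=
  [:: [:: 3; 1; 2; 5; 4; 0], [:: 1; 3; 2; 5; 4; 0] & common_orders].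

Definition orders2 : seq (seq nat) :=
  [:: [:: 3; 2; 1; 4; 5; 0], [:: 2; 3; 1; 4; 0; 5] & common_orders].

Lemma rich1 : rich_witnesses least_nonzero orders1.
Proof. by vm_compute. Qed.

Lemma rich2 : rich_witnesses least_nonzero_but_123 orders2.
Proof. by vm_compute. Qed.

Lemma extremal_guarded6 (guards : nat -> nat -> nat -> bool)
    (P Q : linorder 'I_6) :
    map val P = [:: 0; 1; 2; 3; 4; 5] -> map val Q = [:: 5; 1; 2; 3; 4; 0] ->
    all (fun x => guards x 0 5) [:: 1; 2; 3; 4] ->
    P \in guarded6 guards -> Q \in guarded6 guards ->
  extremal_path (guarded6 guards) P /\ extremal_path (guarded6 guards) Q.
Proof.
move=> val_P val_Q g05 PD QD.
have startsE (R : linorder 'I_6) a :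
    starts_at R a = (head (val a) (map val R) == val a).
  by rewrite /starts_at; case: (tval R) => [|b s]; rewrite /= ?eqxx.
have endsE (R : linorder 'I_6) a :
    ends_at R a = (last (val a) (map val R) == val a).
  by rewrite last_map.
have terminalE : terminal (guarded6 guards) = [set ord0; ord_max].
  apply/setP => x; apply/idP/idP => [x_term|]; last first.
    rewrite !inE => /orP[] /eqP->; apply/exists_inP.
      by exists Q => //; rewrite endsE val_Q.
    by exists P => //; rewrite endsE val_P.
  have := x_term; apply: contraTT; rewrite in_set2 negb_or => /andP[x0 x5].
  apply: (@guarded_not_terminal _ _ x ord0 ord_max).
    by rewrite /= !inE negb_or x0 x5.
  apply: (allP g05); have := ltn_ord x; move: x0 x5.
  by rewrite -!(inj_eq val_inj) /= !inE; case: (val x) => [|[|[|[|[|[|]]]]]].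
split; split=> //.
  by exists ord0, ord_max; split; rewrite ?startsE ?endsE ?val_P.
by exists ord_max, ord0; split; rewrite ?startsE ?endsE ?val_Q // setUC.
Qed.

Theorem mainTheorem2 :
  exists (A : finType) (P Q : linorder A),
    [/\ #|A| = 6, P != Q &
      exists D E : {set linorder A},
        [/\ maximal_arrow_single_peaked D /\ maximal_arrow_single_peaked E,
            extremal_path D P /\ extremal_path D Q,
            extremal_path E P /\ extremal_path E Q &
            ~ isomorphic D E]].
Proof.
have respects1 s : s \in orders1 -> respects least_nonzero s.
  by case/and4P: rich1 => /allP + _ _ _; apply.
have respects2 s : s \in orders2 -> respects least_nonzero_but_123 s.
  by case/and4P: rich2 => /allP + _ _ _; apply.
have [P val_P] := @linorder_of_seq [:: 0; 1; 2; 3; 4; 5] isT.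
have [Q val_Q] := @linorder_of_seq [:: 5; 1; 2; 3; 4; 0] isT.
pose D := guarded6 least_nonzero; pose E := guarded6 least_nonzero_but_123.
have [PD QD] : P \in D /\ Q \in D.
  by split; apply: mem_guarded6; rewrite ?val_P ?val_Q; apply: respects1.
have [PE QE] : P \in E /\ Q \in E.
  by split; apply: mem_guarded6; rewrite ?val_P ?val_Q; apply: respects2.
exists 'I_6, P, Q; split; first exact: card_ord.
  by apply/eqP => eqPQ; move: val_P; rewrite eqPQ val_Q.
exists D, E; split.
- by split; [exact: guarded6_maximal rich1 | exact: guarded6_maximal rich2].
- exact: (extremal_guarded6 val_P val_Q).
- exact: (extremal_guarded6 val_P val_Q).
(* The element that is always among the two best in the first domain is 1. *)
move=> /isomorphic_top_two[|b b_top].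
  exists (inord 1) => R; apply: always_guard_top_two => y z.
  rewrite /least_nonzero inordK //= !inE negb_or.
  rewrite -!(inj_eq val_inj) /= inordK //.
  by case: (val y) => [|[|?]]; case: (val z) => [|[|?]].
(* The value of b is refuted by computation: each of 0, .., 5 is in third
   position or lower in one of the witnesses of the second domain. *)
have : all (fun s => index (val b) s < 2) orders2.
  apply/allP => s /respects2/respects_guarded6[R RE <-].
  by rewrite (index_map val_inj); apply: b_top.
by case: b {b_top} => [[|[|[|[|[|[|]]]]]]].
Qed.
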